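(* The variety $\mathcal{V}_{\sigma\mathbb{RS}}$ is generated by $\mathbb{R}$: every $G\in\mathcal{V}_{\sigma\mathbb{RS}}$ is isomorphic to a subalgebra of a quotient of a power of the algebra $\mathbb{R}$ with its usual Riesz space operations ($0,+,-,\vee,\wedge$, and $\lambda\cdot-$ for $\lambda\in\mathbb{R}$) and $\bigvee^-(g,f_1,f_2,\dots)=\sup_{n\ge1}\{f_n\wedge g\}$.
   Context: $\mathcal{V}_{\sigma\mathbb{RS}}$ is the infinitary variety of algebras with the Riesz space operations plus a countably infinitary operation $\bigvee^-$ (write $\bigvee_{n\ge1}^g f_n:=\bigvee^-(g,f_1,f_2,\dots)$), satisfying the Riesz space axioms and (A1) $\bigvee_{n\ge1}^g f_n=\bigvee_{n\ge1}^g(f_n\wedge g)$; (A2) $\bigvee_{n\ge1}^g f_n=(f_1\wedge g)\vee\bigvee^-(g,f_2,f_3,\dots)$; (A3) $\bigvee_{n\ge1}^g(f_n\wedge h)\le h$ ($a\le b$ meaning $a\wedge b=a$). *)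

(* Defs.v *)
From Stdlib Require Import Reals ClassicalEpsilon.
Open Scope R_scope.

(** Algebras of the infinitary variety V_{sigma RS}.
    Signature: 0, +, unary -, join, meet, scalar multiplication by each real
    lambda, and the countably infinitary operation bigv g f, where
    bigv g f = \bigvee^-(g, f 0, f 1, f 2, ...)  (so f 0 plays the role of f_1). *)
Record sRS := {
  car :> Type;
  zero : car;
  add : car -> car -> car;
  opp : car -> car;
  join : car -> car -> car;
  meet : car -> car -> car;
  smul : R -> car -> car;
  bigv : car -> (nat -> car) -> car;
  add_assoc : forall x y z, add x (add y z) = add (add x y) z;
  add_comm : forall x y, add x y = add y x;
  add_0 : forall x, add x zero = x;
  add_opp : forall x, add x (opp x) = zero;
  smul_addr : forall r x y, smul r (add x y) = add (smul r x) (smul r y);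
  smul_addl : forall r s x, smul (r + s) x = add (smul r x) (smul s x);
  smul_assoc : forall r s x, smul r (smul s x) = smul (r * s) x;
  smul_1 : forall x, smul 1 x = x;
  join_assoc : forall x y z, join x (join y z) = join (join x y) z;
  join_comm : forall x y, join x y = join y x;
  meet_assoc : forall x y z, meet x (meet y z) = meet (meet x y) z;
  meet_comm : forall x y, meet x y = meet y x;
  join_meet_absorb : forall x y, join x (meet x y) = x;
  meet_join_absorb : forall x y, meet x (join x y) = x;
  (* compatibility of order (a <= b iff meet a b = a) with + and lambda >= 0 *)
  add_mono : forall x y z,
    meet (add (meet x y) z) (add y z) = add (meet x y) z;
  smul_mono : forall r x y, 0 <= r ->
    meet (smul r (meet x y)) (smul r y) = smul r (meet x y);
  A1 : forall g f, bigv g f = bigv g (fun n => meet (f n) g);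
  A2 : forall g f, bigv g f = join (meet (f 0%nat) g) (bigv g (fun n => f (S n)));
  A3 : forall g h f,
    meet (bigv g (fun n => meet (f n) h)) h = bigv g (fun n => meet (f n) h)
}.

(** Supremum of a real sequence (chosen least upper bound of its range;
    only used below for sequences bounded above, where it exists). *)
Definition Rsup_seq (u : nat -> R) : R :=
  epsilon (inhabits 0) (fun l => is_lub (fun x => exists n, x = u n) l).

Definition pw_zero (I : Type) : I -> R := fun _ => 0.
Definition pw_add {I : Type} (a b : I -> R) : I -> R := fun i => a i + b i.
Definition pw_opp {I : Type} (a : I -> R) : I -> R := fun i => - a i.
Definition pw_join {I : Type} (a b : I -> R) : I -> R := fun i => Rmax (a i) (b i).
Definition pw_meet {I : Type} (a b : I -> R) : I -> R := fun i => Rmin (a i) (b i).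
Definition pw_smul {I : Type} (r : R) (a : I -> R) : I -> R := fun i => r * a i.
Definition pw_bigv {I : Type} (g : I -> R) (f : nat -> I -> R) : I -> R :=
  fun i => Rsup_seq (fun n => Rmin (f n i) (g i)).

Definition pw_congruence {I : Type} (th : (I -> R) -> (I -> R) -> Prop) : Prop :=
  (forall a, th a a) /\
  (forall a b, th a b -> th b a) /\
  (forall a b c, th a b -> th b c -> th a c) /\
  (forall a a' b b', th a a' -> th b b' -> th (pw_add a b) (pw_add a' b')) /\
  (forall a a', th a a' -> th (pw_opp a) (pw_opp a')) /\
  (forall a a' b b', th a a' -> th b b' -> th (pw_join a b) (pw_join a' b')) /\
  (forall a a' b b', th a a' -> th b b' -> th (pw_meet a b) (pw_meet a' b')) /\
  (forall r a a', th a a' -> th (pw_smul r a) (pw_smul r a')) /\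
  (forall g g' f f', th g g' -> (forall n, th (f n) (f' n)) ->
     th (pw_bigv g f) (pw_bigv g' f')).

(** h : G -> R^I induces an injective homomorphism G -> R^I / th
    (i.e. an isomorphism of G onto a subalgebra of the quotient R^I / th). *)
Definition embeds_mod (G : sRS) {I : Type} (th : (I -> R) -> (I -> R) -> Prop)
    (h : G -> I -> R) : Prop :=
  (forall x y, th (h x) (h y) -> x = y) /\
  th (h (zero G)) (pw_zero I) /\
  (forall x y, th (h (add G x y)) (pw_add (h x) (h y))) /\
  (forall x, th (h (opp G x)) (pw_opp (h x))) /\
  (forall x y, th (h (join G x y)) (pw_join (h x) (h y))) /\
  (forall x y, th (h (meet G x y)) (pw_meet (h x) (h y))) /\
  (forall r x, th (h (smul G r x)) (pw_smul r (h x))) /\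
  (forall g f, th (h (bigv G g f)) (pw_bigv (h g) (fun n => h (f n)))).

(* Main.v *)
(** An element [u > 0] of a σ-complete Riesz space and countably many instances of
    [bigv] admit a real partial valuation, sending [u] to 1, which is a
    homomorphism where defined and preserves those suprema (Rasiowa–Sikorski):
    let [p > 0] force [x <= 0] when [p] is disjoint from the positive part of [x];
    a decreasing sequence below [u] that meets countably many dense sets decides
    every comparison of a relevant element with a rational multiple of [u], and
    hence gives it a Dedekind cut. Boundedness of the cuts is the Archimedean
    property and preservation of the suprema is infinite distributivity.

    Take [I] to be the set of all partial valuations, send [x] to its evaluation
    map, and identify two functions on [I] that agree on all valuations respecting
    some countable family of instances of [bigv]. Countable families are closed
    under countable unions, so this is a congruence, and the valuation sending
    [pos (x - y)] to 1 makes the map injective. *)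

Require Import Defs.
From Stdlib Require Import Reals.
From Stdlib Require Import Lra Lia Cantor Classical ClassicalEpsilon FunctionalExtensionality.

Local Notation "x +' y" := (add _ x y) (at level 50, left associativity).
Local Notation "-' x" := (opp _ x) (at level 35, right associativity).
Local Notation "r *' x" := (smul _ r x) (at level 40).

Definition le {G : sRS} (x y : G) : Prop := meet G x y = x.
Local Notation "x <=' y" := (le x y) (at level 70).

Definition pos {G : sRS} (x : G) : G := join G x (zero G).

(** * Lattice order *)

Lemma le_refl {G : sRS} (x : G) : x <=' x.
Proof.
  unfold le. rewrite <- (join_meet_absorb G x x) at 2. apply meet_join_absorb.
Qed.

Lemma le_antisym {G : sRS} (x y : G) : x <=' y -> y <=' x -> x = y.
Proof. unfold le. intros H1 H2. rewrite <- H1, meet_comm. exact H2. Qed.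

Lemma le_trans {G : sRS} (x y z : G) : x <=' y -> y <=' z -> x <=' z.
Proof. unfold le. intros H1 H2. rewrite <- H1, <- meet_assoc, H2. reflexivity. Qed.

Lemma meet_le_r {G : sRS} (x y : G) : meet G x y <=' y.
Proof. unfold le. rewrite <- meet_assoc. f_equal. apply le_refl. Qed.

Lemma meet_le_l {G : sRS} (x y : G) : meet G x y <=' x.
Proof. rewrite meet_comm. apply meet_le_r. Qed.

Lemma meet_glb {G : sRS} (x y z : G) : z <=' x -> z <=' y -> z <=' meet G x y.
Proof. unfold le. intros H1 H2. rewrite meet_assoc, H1. exact H2. Qed.

Lemma join_ge_l {G : sRS} (x y : G) : x <=' join G x y.
Proof. apply meet_join_absorb. Qed.

Lemma join_ge_r {G : sRS} (x y : G) : y <=' join G x y.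
Proof. rewrite join_comm. apply join_ge_l. Qed.

Lemma join_eq_r {G : sRS} (x z : G) : x <=' z -> join G x z = z.
Proof.
  intros H. rewrite join_comm, <- H, (meet_comm G x z). apply join_meet_absorb.
Qed.

Lemma join_lub {G : sRS} (x y z : G) : x <=' z -> y <=' z -> join G x y <=' z.
Proof.
  intros H1 H2. unfold le.
  rewrite <- (join_eq_r x z H1), <- (join_eq_r y z H2), join_assoc.
  apply meet_join_absorb.
Qed.

Lemma meet_mono {G : sRS} (x y x' y' : G) :
  x <=' x' -> y <=' y' -> meet G x y <=' meet G x' y'.
Proof.
  intros H1 H2. apply meet_glb.
  - exact (le_trans _ _ _ (meet_le_l x y) H1).
  - exact (le_trans _ _ _ (meet_le_r x y) H2).
Qed.

(** * Ordered vector space *)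

Lemma add_0l {G : sRS} (x : G) : zero G +' x = x.
Proof. rewrite add_comm. apply add_0. Qed.

Lemma add_addK {G : sRS} (x y : G) : x +' y +' -' y = x.
Proof. rewrite <- add_assoc, add_opp. apply add_0. Qed.

Lemma add_oppK {G : sRS} (x y : G) : x +' -' y +' y = x.
Proof. rewrite <- add_assoc, (add_comm G (-' y)), add_opp. apply add_0. Qed.

Lemma opp_unique {G : sRS} (x y : G) : x +' y = zero G -> y = -' x.
Proof.
  intros H. rewrite <- (add_addK y x), (add_comm G y x), H. apply add_0l.
Qed.

Lemma add_swap {G : sRS} (a b c d : G) : (a +' b) +' (c +' d) = (a +' c) +' (b +' d).
Proof.
  rewrite <- !add_assoc. f_equal. rewrite !add_assoc. f_equal. apply add_comm.
Qed.

Lemma opp_opp {G : sRS} (x : G) : -' -' x = x.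
Proof. symmetry. apply opp_unique. rewrite add_comm. apply add_opp. Qed.

Lemma opp_add {G : sRS} (x y : G) : -' (x +' y) = -' x +' -' y.
Proof.
  symmetry. apply opp_unique. rewrite add_swap, !add_opp. apply add_0.
Qed.

Lemma smul_0l {G : sRS} (x : G) : 0 *' x = zero G.
Proof.
  rewrite <- (add_addK (0 *' x) (0 *' x)), <- smul_addl, Rplus_0_l. apply add_opp.
Qed.

Lemma smul_0r {G : sRS} (r : R) : r *' zero G = zero G.
Proof. rewrite <- (smul_0l (zero G)), smul_assoc, Rmult_0_r. reflexivity. Qed.

Lemma smul_oppl {G : sRS} (r : R) (x : G) : (- r) *' x = -' (r *' x).
Proof.
  apply opp_unique. rewrite <- smul_addl, Rplus_opp_r. apply smul_0l.
Qed.

Lemma smul_oppr {G : sRS} (r : R) (x : G) : r *' (-' x) = -' (r *' x).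
Proof.
  apply opp_unique. rewrite <- smul_addr, add_opp. apply smul_0r.
Qed.

Lemma add_le_r {G : sRS} (x y z : G) : x <=' y -> x +' z <=' y +' z.
Proof.
  intros H. pose proof (add_mono G x y z) as E. rewrite H in E. exact E.
Qed.

Lemma add_le {G : sRS} (x y x' y' : G) : x <=' x' -> y <=' y' -> x +' y <=' x' +' y'.
Proof.
  intros H1 H2. apply (le_trans _ (x' +' y)); [now apply add_le_r|].
  rewrite !(add_comm G x'). now apply add_le_r.
Qed.

Lemma le_subr {G : sRS} (x y z : G) : x +' z <=' y -> x <=' y +' -' z.
Proof. intros H. apply (add_le_r _ _ (-' z)) in H. now rewrite add_addK in H. Qed.

Lemma le_addr {G : sRS} (x y z : G) : x <=' y +' -' z -> x +' z <=' y.
Proof. intros H. apply (add_le_r _ _ z) in H. now rewrite add_oppK in H. Qed.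

Lemma le_subl {G : sRS} (x y z : G) : x <=' y +' z -> x +' -' z <=' y.
Proof. intros H. apply (add_le_r _ _ (-' z)) in H. now rewrite add_addK in H. Qed.

Lemma le_addl {G : sRS} (x y z : G) : x +' -' z <=' y -> x <=' y +' z.
Proof. intros H. apply (add_le_r _ _ z) in H. now rewrite add_oppK in H. Qed.

Lemma le_opp {G : sRS} (x y : G) : x <=' y -> -' y <=' -' x.
Proof.
  intros H. rewrite <- (add_0l (-' y)). apply le_subl. rewrite add_comm.
  apply le_subr. now rewrite add_0l.
Qed.

Lemma opp_le_0 {G : sRS} (x : G) : zero G <=' x -> -' x <=' zero G.
Proof.
  intros H. rewrite <- (add_0 G (-' x)), add_comm. apply (le_trans _ (x +' -' x)).
  - now apply add_le_r.
  - rewrite add_opp. apply le_refl.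
Qed.

Lemma le_0_of_add_le {G : sRS} (x y : G) : x +' y <=' x -> y <=' zero G.
Proof.
  intros H. rewrite add_comm in H. apply le_subr in H. now rewrite add_opp in H.
Qed.

Lemma smul_le {G : sRS} (r : R) (x y : G) : 0 <= r -> x <=' y -> r *' x <=' r *' y.
Proof.
  intros Hr H. pose proof (smul_mono G r x y Hr) as E. rewrite H in E. exact E.
Qed.

Lemma smul_ge_0 {G : sRS} (r : R) (x : G) :
  0 <= r -> zero G <=' x -> zero G <=' r *' x.
Proof. intros Hr H. rewrite <- (smul_0r r). now apply smul_le. Qed.

Lemma smul_le_l {G : sRS} (r s : R) (x : G) :
  r <= s -> zero G <=' x -> r *' x <=' s *' x.
Proof.
  intros Hr H. replace s with (r + (s - r)) by lra. rewrite smul_addl.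
  rewrite <- (add_0 G (r *' x)) at 1. apply add_le; [apply le_refl|].
  apply smul_ge_0; [lra|exact H].
Qed.

Lemma pos_ge_0 {G : sRS} (x : G) : zero G <=' pos x.
Proof. apply join_ge_r. Qed.

Lemma pos_ge {G : sRS} (x : G) : x <=' pos x.
Proof. apply join_ge_l. Qed.

Lemma pos_mono {G : sRS} (x y : G) : x <=' y -> pos x <=' pos y.
Proof.
  intros H. apply join_lub; [|apply pos_ge_0]. exact (le_trans _ _ _ H (pos_ge y)).
Qed.

Lemma add_ge_0 {G : sRS} (x y : G) :
  zero G <=' x -> zero G <=' y -> zero G <=' x +' y.
Proof. intros H1 H2. rewrite <- (add_0 G (zero G)). now apply add_le. Qed.

Lemma pos_add_le {G : sRS} (x y : G) : pos (x +' y) <=' pos x +' pos y.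
Proof.
  apply join_lub; [apply add_le; apply pos_ge|apply add_ge_0; apply pos_ge_0].
Qed.

(** Both [x] and 0 lie below [pos x - w], because [w <= pos (-x) <= pos x - x] and [w <= pos x].
    Hence [pos x <= pos x - w], so [w <= 0]. *)
Lemma meet_pos_pos_opp {G : sRS} (x : G) : meet G (pos x) (pos (-' x)) = zero G.
Proof.
  apply le_antisym; [|apply meet_glb; apply pos_ge_0].
  set (w := meet G _ _).
  apply (le_0_of_add_le (pos x)). apply le_addr. apply join_lub; apply le_subr.
  - rewrite add_comm. apply le_addr.
    apply (le_trans _ (pos (-' x))); [apply meet_le_r|].
    apply join_lub; apply le_subr.
    + rewrite add_comm, add_opp. apply pos_ge_0.
    + rewrite add_0l. apply pos_ge.
  - rewrite add_0l. apply meet_le_l.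
Qed.

Lemma meet_add_le {G : sRS} (p a b : G) :
  zero G <=' p -> zero G <=' a -> zero G <=' b ->
  meet G (a +' b) p <=' meet G a p +' meet G b p.
Proof.
  intros Hp Ha Hb.
  assert (sub_le : forall x y : G, zero G <=' y -> x +' -' y <=' x).
  { intros x y H. rewrite <- (add_0 G x) at 2. apply add_le; [apply le_refl|].
    now apply opp_le_0. }
  set (w := meet G (a +' b) p). set (m := meet G b p).
  (* [w - a] lies below [b] and below [p], hence below [m]; the same argument then puts [w - m]
     below [a] and below [p]. *)
  assert (Hw : w <=' a +' m).
  { rewrite add_comm. apply le_addl. apply meet_glb.
    - apply le_subl. rewrite add_comm. apply meet_le_l.
    - apply (le_trans _ w); [now apply sub_le|apply meet_le_r]. }
  apply le_addl. apply meet_glb.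
  - now apply le_subl.
  - apply (le_trans _ w); [|apply meet_le_r]. apply sub_le. now apply meet_glb.
Qed.

(** * The infinitary operation as a supremum, and the Archimedean property *)

Lemma bigv_ub {G : sRS} (g : G) (f : nat -> G) (n : nat) :
  meet G (f n) g <=' bigv G g f.
Proof.
  revert f. induction n as [|n IH]; intros f; rewrite Defs.A2.
  - apply join_ge_l.
  - exact (le_trans _ _ _ (IH (fun n => f (S n))) (join_ge_r _ _)).
Qed.

(** A1 truncates the terms at [g]; meeting them with [h] then changes nothing, and A3 applies. With
    [bigv_ub], this makes [bigv g f] the least upper bound of the [f n /\ g]. *)
Lemma bigv_lub {G : sRS} (g h : G) (f : nat -> G) :
  (forall n, meet G (f n) g <=' h) -> bigv G g f <=' h.
Proof.
  intros H. rewrite Defs.A1.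
  replace (fun n => meet G (f n) g) with (fun n => meet G (meet G (f n) g) h).
  - apply Defs.A3.
  - extensionality n. apply H.
Qed.

(** Let [s] be the supremum of the multiples [n p], all below [e]. Then [n p + p <= s] for every
    [n], so [s <= s - p]. *)
Lemma archimedean {G : sRS} (p e : G) :
  (forall n, INR n *' p <=' e) -> p <=' zero G.
Proof.
  intros H. set (f := fun n => INR n *' p).
  apply (le_0_of_add_le (bigv G e f)). apply le_addr. apply bigv_lub. intros n.
  apply (le_trans _ (f n)); [apply meet_le_l|]. apply le_subr.
  replace (f n +' p) with (f (S n)).
  - apply (le_trans _ (meet G (f (S n)) e)); [|apply bigv_ub].
    apply meet_glb; [apply le_refl|apply H].
  - unfold f. rewrite S_INR, smul_addl, smul_1. reflexivity.
Qed.

(** * Generic sequences *)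

(* [p] lies in the polar of the positive part of [x]; modulo the ideal of
   elements disjoint from [p] this says [x <= 0]. *)
Definition forces_le0 {G : sRS} (p x : G) : Prop := meet G (pos x) p = zero G.

Definition gt0 {G : sRS} (p : G) : Prop := zero G <=' p /\ p <> zero G.

Lemma gt0_meet {G : sRS} (a p : G) :
  zero G <=' a -> zero G <=' p -> meet G a p <> zero G -> gt0 (meet G a p).
Proof. intros Ha Hp H. split; [now apply meet_glb|exact H]. Qed.

Lemma forces_of_le {G : sRS} (p x y : G) :
  zero G <=' p -> x <=' y -> forces_le0 p y -> forces_le0 p x.
Proof.
  unfold forces_le0. intros Hp Hxy H. apply le_antisym.
  - rewrite <- H. apply meet_mono; [now apply pos_mono|apply le_refl].
  - apply meet_glb; [apply pos_ge_0|exact Hp].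
Qed.

Lemma forces_anti {G : sRS} (p q x : G) :
  zero G <=' q -> q <=' p -> forces_le0 p x -> forces_le0 q x.
Proof.
  unfold forces_le0. intros Hq Hqp H. apply le_antisym.
  - rewrite <- H. apply meet_mono; [apply le_refl|exact Hqp].
  - apply meet_glb; [apply pos_ge_0|exact Hq].
Qed.

Lemma forces_le_0 {G : sRS} (p x : G) :
  zero G <=' p -> x <=' zero G -> forces_le0 p x.
Proof.
  intros Hp H. apply (forces_of_le _ _ _ Hp H). unfold forces_le0.
  apply le_antisym.
  - apply (le_trans _ (pos (zero G))); [apply meet_le_l|].
    apply join_lub; apply le_refl.
  - apply meet_glb; [apply pos_ge_0|exact Hp].
Qed.

Lemma forces_pos_add {G : sRS} (p x y : G) :
  zero G <=' p -> forces_le0 p x -> forces_le0 p y ->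
  forces_le0 p (pos x +' pos y).
Proof.
  unfold forces_le0. intros Hp Hx Hy.
  assert (E : pos (pos x +' pos y) = pos x +' pos y).
  { apply le_antisym; [|apply pos_ge].
    apply join_lub; [apply le_refl|apply add_ge_0; apply pos_ge_0]. }
  rewrite E. apply le_antisym.
  - apply (le_trans _ (meet G (pos x) p +' meet G (pos y) p)).
    + apply meet_add_le; [exact Hp|apply pos_ge_0|apply pos_ge_0].
    + rewrite Hx, Hy, add_0. apply le_refl.
  - apply meet_glb; [apply add_ge_0; apply pos_ge_0|exact Hp].
Qed.

Lemma forces_add {G : sRS} (p x y : G) :
  zero G <=' p -> forces_le0 p x -> forces_le0 p y -> forces_le0 p (x +' y).
Proof.
  intros Hp Hx Hy. apply (forces_of_le _ _ _ Hp (pos_ge _)).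
  apply (forces_of_le _ _ _ Hp (pos_add_le _ _)). now apply forces_pos_add.
Qed.

Lemma smul_meet_le {G : sRS} (r : R) (x y : G) :
  0 < r -> meet G (r *' x) (r *' y) <=' r *' meet G x y.
Proof.
  intros Hr. assert (Hr' : 0 <= / r) by (apply Rlt_le, Rinv_0_lt_compat, Hr).
  set (w := meet G _ _).
  assert (E : forall z : G, r *' (/ r *' z) = z /\ / r *' (r *' z) = z).
  { intros z. rewrite !smul_assoc, Rinv_r, Rinv_l by lra. rewrite smul_1. auto. }
  rewrite <- (proj1 (E w)). apply smul_le; [lra|]. apply meet_glb.
  - rewrite <- (proj2 (E x)). apply smul_le; [exact Hr'|apply meet_le_l].
  - rewrite <- (proj2 (E y)). apply smul_le; [exact Hr'|apply meet_le_r].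
Qed.

Lemma forces_smul {G : sRS} (p x : G) (r : R) :
  zero G <=' p -> 0 <= r -> forces_le0 p x -> forces_le0 p (r *' x).
Proof.
  unfold forces_le0. intros Hp Hr H. apply le_antisym.
  (* The factor [r + 1] is at least 1, so [p <= (r + 1) p], and it is positive even when [r = 0], as
     [smul_meet_le] requires. *)
  - apply (le_trans _ (meet G ((r + 1) *' pos x) ((r + 1) *' p))).
    + apply meet_mono.
      * apply join_lub.
        -- apply (le_trans _ (r *' pos x)).
           ++ apply smul_le; [exact Hr|apply pos_ge].
           ++ apply smul_le_l; [lra|apply pos_ge_0].
        -- apply smul_ge_0; [lra|apply pos_ge_0].
      * rewrite <- (smul_1 G p) at 1. apply smul_le_l; [lra|exact Hp].
    + apply (le_trans _ ((r + 1) *' meet G (pos x) p)); [apply smul_meet_le; lra|].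
      rewrite H, smul_0r. apply le_refl.
  - apply meet_glb; [apply pos_ge_0|exact Hp].
Qed.

(** The basic refinement: when [p] fails to force [x <= 0], this meet is a nonzero element below [p]
    that forces the opposite inequality. *)
Lemma forces_pos_meet {G : sRS} (p x : G) :
  zero G <=' p -> forces_le0 (meet G (pos x) p) (-' x).
Proof.
  intros Hp. unfold forces_le0.
  rewrite meet_assoc, (meet_comm G (pos (-' x))), meet_pos_pos_opp.
  exact Hp.
Qed.

Lemma not_forces_smul {G : sRS} (p u : G) (r : R) :
  gt0 p -> p <=' u -> 0 < r -> ~ forces_le0 p (r *' u).
Proof.
  intros [Hp Hp0] Hpu Hr H. apply Hp0.
  apply (forces_smul _ _ (/ r)) in H;
    [|exact Hp|apply Rlt_le, Rinv_0_lt_compat, Hr].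
  rewrite smul_assoc, Rinv_l, smul_1 in H by lra.
  rewrite <- H. symmetry. rewrite meet_comm.
  exact (le_trans _ _ _ Hpu (pos_ge u)).
Qed.

Lemma forces_decide {G : sRS} (p x : G) :
  gt0 p -> exists q, gt0 q /\ q <=' p /\ (forces_le0 q x \/ forces_le0 q (-' x)).
Proof.
  intros [Hp Hp0]. destruct (classic (forces_le0 p x)) as [H|H].
  - exists p. repeat split; auto using le_refl.
  - exists (meet G (pos x) p).
    split; [now apply gt0_meet; [apply pos_ge_0| |]|].
    split; [apply meet_le_r|right; now apply forces_pos_meet].
Qed.

(** Otherwise [p] forces [n u <= x] for every [n], since a failure at [n] could be refined to force
    [x <= n u]. Then [n p <= pos x] for all [n], against the Archimedean property. *)
Lemma forces_bounded {G : sRS} (p u x : G) :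
  gt0 p -> p <=' u ->
  exists q, gt0 q /\ q <=' p /\ exists a, forces_le0 q (x +' (- a) *' u).
Proof.
  intros [Hp Hp0] Hpu. apply NNPP. intros Hno. apply Hp0.
  apply le_antisym; [|exact Hp]. apply (archimedean _ (pos x)). intros n.
  set (z := x +' (- INR n) *' u).
  assert (Hz : forces_le0 p (-' z)).
  { apply NNPP. intros H. apply Hno. exists (meet G (pos (-' z)) p).
    split; [now apply gt0_meet; [apply pos_ge_0| |]|].
    split; [apply meet_le_r|]. exists (INR n). fold z.
    rewrite <- (opp_opp z) at 2. now apply forces_pos_meet. }
  pose proof (pos_INR n) as Hn.
  (* [d <= n p], while [d] is disjoint from [p]; hence [d <= 0] and [n p <= pos x]. *)
  set (d := pos (INR n *' p +' -' pos x)).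
  assert (Hd : forces_le0 p (INR n *' p +' -' pos x)).
  { apply (forces_of_le _ _ (-' z) Hp); [|exact Hz].
    unfold z. rewrite opp_add, smul_oppl, opp_opp, add_comm. apply add_le.
    - apply le_opp, pos_ge.
    - now apply smul_le. }
  (* Since [d <= (n + 1) p], dividing by [n + 1], nonzero also at [n = 0], puts [d] below [p]
     itself, so disjointness applies. *)
  assert (Hk : 0 < / (INR n + 1)) by (apply Rinv_0_lt_compat; lra).
  assert (Hk1 : / (INR n + 1) <= 1).
  { rewrite <- Rinv_1. apply Rinv_le_contravar; lra. }
  assert (He : / (INR n + 1) *' d <=' zero G).
  { rewrite <- Hd. apply meet_glb.
    - rewrite <- (smul_1 G (pos _)). apply smul_le_l; [exact Hk1|apply pos_ge_0].
    - apply (le_trans _ (/ (INR n + 1) *' ((INR n + 1) *' p))).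
      + apply smul_le; [lra|]. apply join_lub; [|apply smul_ge_0; [lra|exact Hp]].
        apply le_subl. rewrite <- (add_0 G (INR n *' p)).
        apply add_le; [apply smul_le_l; [lra|exact Hp]|apply pos_ge_0].
      + rewrite smul_assoc, Rinv_l, smul_1 by lra. apply le_refl. }
  apply (smul_le (INR n + 1)) in He; [|lra].
  rewrite smul_assoc, Rinv_r, smul_1, smul_0r in He by lra.
  rewrite <- (add_0l (pos x)). apply le_addl.
  exact (le_trans _ _ _ (pos_ge _) He).
Qed.

(* If [p] forces all [f n /\ g <= c], then [w := pos (s - c) /\ p] satisfies
   [f n /\ g <= s - w] for all [n], hence [s <= s - w] and [w = 0]. *)
Lemma forces_bigv {G : sRS} (p g c : G) (f : nat -> G) :
  zero G <=' p ->
  (forall n, forces_le0 p (meet G (f n) g +' -' c)) ->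
  forces_le0 p (bigv G g f +' -' c).
Proof.
  intros Hp H. unfold forces_le0. set (s := bigv G g f). set (w := meet G _ p).
  assert (Hw : zero G <=' w) by (apply meet_glb; [apply pos_ge_0|exact Hp]).
  apply le_antisym; [|exact Hw].
  apply (le_0_of_add_le s). apply le_addr. apply bigv_lub. intros n. apply le_subr.
  set (t := meet G (f n) g). set (b := pos (t +' -' c)).
  assert (Hts : zero G <=' s +' -' t).
  { apply le_subr. rewrite add_0l. apply bigv_ub. }
  assert (Hsum : pos (s +' -' c) <=' (s +' -' t) +' b).
  { apply join_lub; [|apply add_ge_0; [exact Hts|apply pos_ge_0]].
    apply (le_trans _ ((s +' -' t) +' (t +' -' c))).
    - rewrite add_assoc, add_oppK. apply le_refl.
    - apply add_le; [apply le_refl|apply pos_ge]. }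
  assert (Hbw : meet G b w = zero G).
  { apply (forces_anti p w); [exact Hw|apply meet_le_r|apply H]. }
  rewrite add_comm. apply le_addr.
  apply (le_trans _ (meet G (s +' -' t) w +' meet G b w)).
  - apply (le_trans _ (meet G ((s +' -' t) +' b) w)).
    + apply meet_glb; [|apply le_refl].
      exact (le_trans _ _ _ (meet_le_l _ _) Hsum).
    + apply meet_add_le; [exact Hw|exact Hts|apply pos_ge_0].
  - rewrite Hbw, add_0. apply meet_le_l.
Qed.

(** The dense set attached to a supremum: below any [p], either [c] bounds it or a single term
    already reaches [c]. This prevents a gap between the values of the terms and that of the
    supremum. *)
Lemma forces_bigv_decide {G : sRS} (p g c : G) (f : nat -> G) :
  gt0 p -> exists q, gt0 q /\ q <=' p /\
    (forces_le0 q (bigv G g f +' -' c) \/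
     exists n, forces_le0 q (-' (meet G (f n) g +' -' c))).
Proof.
  intros [Hp Hp0].
  destruct (classic (forall n, forces_le0 p (meet G (f n) g +' -' c))) as [H|H].
  - exists p. repeat split; auto using le_refl, forces_bigv.
  - apply not_all_ex_not in H. destruct H as [n H].
    exists (meet G (pos (meet G (f n) g +' -' c)) p).
    split; [now apply gt0_meet; [apply pos_ge_0| |]|].
    split; [apply meet_le_r|]. right. exists n. now apply forces_pos_meet.
Qed.

Definition chain_below {G : sRS} (u : G) (P : nat -> G) : Prop :=
  (forall n, gt0 (P n) /\ P n <=' u) /\ (forall m n, (m <= n)%nat -> P n <=' P m).

Lemma generic_sequence {G : sRS} (u : G) (D : nat -> G -> Prop) :
  gt0 u ->
  (forall n p, gt0 p -> p <=' u -> exists q, gt0 q /\ q <=' p /\ D n q) ->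
  exists P : nat -> G,
    chain_below u P /\ (forall n, exists m, D n (P m)).
Proof.
  intros Hu HD.
  set (T := {p : G | gt0 p /\ p <=' u}).
  assert (step : forall n (p : T), {q : T | proj1_sig q <=' proj1_sig p /\
                                            D n (proj1_sig q)}).
  { intros n [p [Hp Hpu]]. apply constructive_indefinite_description.
    destruct (HD n p Hp Hpu) as (q & Hq & Hqp & Hd).
    exists (exist _ q (conj Hq (le_trans _ _ _ Hqp Hpu))). now split. }
  set (P := nat_rect (fun _ => T) (exist _ u (conj Hu (le_refl u)))
              (fun n p => proj1_sig (step n p))).
  (* The chain starts at [u], so [D n] is met at index [S n]. *)
  exists (fun n => proj1_sig (P n)). split; [split|].
  - intros n. exact (proj2_sig (P n)).
  - intros m n Hmn. induction Hmn as [|n _ IH]; [apply le_refl|].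
    exact (le_trans _ _ _ (proj1 (proj2_sig (step n (P n)))) IH).
  - intros n. exists (S n). exact (proj2 (proj2_sig (step n (P n)))).
Qed.

(** The naturals must enumerate the rationals, because each comparison with a rational multiple of
    [u] costs one dense set. The difference gives both signs, and [S m] keeps the denominator
    nonzero. *)
Definition rational (t : nat) : R :=
  let (i, s) := of_nat t in let (j, m) := of_nat s in
  (INR i - INR j) / INR (S m).

Lemma rational_dense (a b : R) : a < b -> exists t, a < rational t < b.
Proof.
  intros Hab.
  destruct (archimed_cor1 (b - a)) as (m & Hm & Hm0); [lra|].
  destruct m as [|m]; [lia|].
  set (k := INR (S m)) in *. assert (Hk : 0 < k) by (apply lt_0_INR; lia).
  destruct (archimed (a * k)) as [H1 H2]. set (z := up (a * k)) in *.
  (* One of the two truncations vanishes, so their difference is the signed integer [z], the first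
     one above [a k]. *)
  exists (to_nat (Z.to_nat z, to_nat (Z.to_nat (- z), m))).
  unfold rational. rewrite !cancel_of_to. fold k.
  replace (INR (Z.to_nat z) - INR (Z.to_nat (- z))) with (IZR z).
  - assert (Hbk : 1 < (b - a) * k).
    { apply (Rmult_lt_compat_r k) in Hm; [|exact Hk].
      rewrite Rinv_l in Hm by lra. exact Hm. }
    split.
    + apply (Rmult_lt_reg_r k); [exact Hk|]. unfold Rdiv.
      rewrite Rmult_assoc, Rinv_l by lra. lra.
    + apply (Rmult_lt_reg_r k); [exact Hk|]. unfold Rdiv.
      rewrite Rmult_assoc, Rinv_l by lra. lra.
  - rewrite !INR_IZR_INZ, <- minus_IZR. f_equal. lia.
Qed.

(** * Partial valuations *)

(** The graph of a Riesz homomorphism into the reals defined on a Riesz subspace. Preservation of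
    [bigv] is kept apart in [respects], because a chain can take care of only countably many
    instances. *)
Record valuation (G : sRS) := {
  value :> G -> R -> Prop;
  value_unique : forall x a b, value x a -> value x b -> a = b;
  value_zero : value (zero G) 0;
  value_add : forall x y a b, value x a -> value y b -> value (x +' y) (a + b);
  value_opp : forall x a, value x a -> value (-' x) (- a);
  value_join : forall x y a b,
    value x a -> value y b -> value (join G x y) (Rmax a b);
  value_meet : forall x y a b,
    value x a -> value y b -> value (meet G x y) (Rmin a b);
  value_smul : forall r x a, value x a -> value (r *' x) (r * a)
}.

Definition respects {G : sRS} (V : valuation G) (c : G * (nat -> G)) : Prop :=
  let (g, f) := c in
  (exists a, V g a) /\ (forall n, exists a, V (f n) a) /\
  (forall a b, V g a -> (forall n, V (f n) (b n)) ->
     V (bigv G g f) (Rsup_seq (fun n => Rmin (b n) a))).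

(** * Real values obtained as cuts along a chain *)

(* [a] bounds from above the value of [x] in the unit [u]. *)
Definition upper {G : sRS} (u : G) (P : nat -> G) (x : G) (a : R) : Prop :=
  exists n, forces_le0 (P n) (x +' (- a) *' u).

(** Lower bounds of [x] are encoded as upper bounds of [-x]. The inequalities are strict because the
    bound [v] itself may never be forced. *)
Definition cut_value {G : sRS} (u : G) (P : nat -> G) (x : G) (v : R) : Prop :=
  (forall a, v < a -> upper u P x a) /\ (forall a, - v < a -> upper u P (-' x) a).

Lemma chain_ge_0 {G : sRS} (u : G) (P : nat -> G) (n : nat) :
  chain_below u P -> zero G <=' P n.
Proof. intros [H _]. apply H. Qed.

Lemma chain_unit_ge_0 {G : sRS} (u : G) (P : nat -> G) :
  chain_below u P -> zero G <=' u.
Proof. intros [H _]. exact (le_trans _ _ _ (proj1 (proj1 (H 0%nat))) (proj2 (H 0%nat))). Qed.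

Lemma chain_directed {G : sRS} (u : G) (P : nat -> G) (x y : G) (m n : nat) :
  chain_below u P -> forces_le0 (P m) x -> forces_le0 (P n) y ->
  exists k, forces_le0 (P k) x /\ forces_le0 (P k) y.
Proof.
  intros HP Hx Hy. exists (Nat.max m n). split.
  - apply (forces_anti (P m)); [now apply (chain_ge_0 u)|apply HP; lia|exact Hx].
  - apply (forces_anti (P n)); [now apply (chain_ge_0 u)|apply HP; lia|exact Hy].
Qed.

Lemma upper_mono {G : sRS} (u : G) (P : nat -> G) (x y : G) (a b : R) :
  chain_below u P -> y <=' x -> a <= b -> upper u P x a -> upper u P y b.
Proof.
  intros HP Hyx Hab [n H]. exists n.
  apply (forces_of_le _ _ _ (chain_ge_0 _ _ n HP)) with (2 := H).
  apply add_le; [exact Hyx|].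
  apply smul_le_l; [lra|exact (chain_unit_ge_0 _ _ HP)].
Qed.

Lemma upper_add {G : sRS} (u : G) (P : nat -> G) (x y : G) (a b : R) :
  chain_below u P -> upper u P x a -> upper u P y b -> upper u P (x +' y) (a + b).
Proof.
  intros HP [m Hx] [n Hy].
  destruct (chain_directed _ _ _ _ _ _ HP Hx Hy) as (k & Hx' & Hy'). exists k.
  rewrite Ropp_plus_distr, smul_addl, add_swap.
  apply forces_add; [exact (chain_ge_0 _ _ k HP)|exact Hx'|exact Hy'].
Qed.

Lemma upper_join {G : sRS} (u : G) (P : nat -> G) (x y : G) (a : R) :
  chain_below u P -> upper u P x a -> upper u P y a -> upper u P (join G x y) a.
Proof.
  intros HP [m Hx] [n Hy].
  destruct (chain_directed _ _ _ _ _ _ HP Hx Hy) as (k & Hx' & Hy'). exists k.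
  pose proof (chain_ge_0 _ _ k HP) as Hk. set (c := (- a) *' u) in *.
  (* A sum of positive parts dominates both [x + c] and [y + c], hence their join, and is forced by
     [forces_pos_add]. *)
  apply (forces_of_le _ _ (pos (x +' c) +' pos (y +' c)) Hk);
    [|now apply forces_pos_add].
  apply le_addr. apply join_lub; apply le_subr.
  - apply (le_trans _ (pos (x +' c))); [apply pos_ge|].
    rewrite <- (add_0 G (pos (x +' c))) at 1.
    apply add_le; [apply le_refl|apply pos_ge_0].
  - apply (le_trans _ (pos (y +' c))); [apply pos_ge|].
    rewrite <- (add_0l (pos (y +' c))) at 1.
    apply add_le; [apply pos_ge_0|apply le_refl].
Qed.

Lemma upper_smul {G : sRS} (u : G) (P : nat -> G) (x : G) (r a : R) :
  chain_below u P -> 0 <= r -> upper u P x a -> upper u P (r *' x) (r * a).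
Proof.
  intros HP Hr [n H]. exists n.
  apply (forces_smul _ _ r (chain_ge_0 _ _ n HP) Hr) in H.
  rewrite smul_addr, smul_assoc in H.
  now replace (- (r * a)) with (r * - a) by ring.
Qed.

Lemma upper_of_le {G : sRS} (u : G) (P : nat -> G) (x : G) (a : R) :
  chain_below u P -> x <=' a *' u -> upper u P x a.
Proof.
  intros HP H. exists 0%nat. apply forces_le_0; [exact (chain_ge_0 _ _ _ HP)|].
  rewrite smul_oppl. apply le_subl. now rewrite add_0l.
Qed.

(** Consistency of the bounds: adding them cancels [x], and [a + b < 0] would make some [P n] force
    a positive multiple of [u] to be at most 0. *)
Lemma upper_opp_ge {G : sRS} (u : G) (P : nat -> G) (x : G) (a b : R) :
  chain_below u P -> upper u P x a -> upper u P (-' x) b -> 0 <= a + b.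
Proof.
  intros HP Hx Hy. apply Rnot_lt_le. intros Hlt.
  destruct (upper_add _ _ _ _ _ _ HP Hx Hy) as [n H].
  rewrite add_opp, add_0l in H.
  destruct (proj1 HP n) as [Hn Hnu].
  apply (not_forces_smul _ _ _ Hn Hnu) with (2 := H). lra.
Qed.

Lemma cut_value_unique {G : sRS} (u : G) (P : nat -> G) (x : G) (v w : R) :
  chain_below u P -> cut_value u P x v -> cut_value u P x w -> v = w.
Proof.
  intros HP.
  assert (half : forall v w, cut_value u P x v -> cut_value u P x w -> w <= v).
  { intros v' w' [Hv _] [_ Hw]. apply Rnot_lt_le. intros Hlt.
    (* With a third of the gap, the two bounds [v' + d] and [- w' + d] add up to [- d < 0]. *)
    set (d := (w' - v') / 3).
    assert (H1 : upper u P x (v' + d)) by (apply Hv; unfold d; lra).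
    assert (H2 : upper u P (-' x) (- w' + d)) by (apply Hw; unfold d; lra).
    pose proof (upper_opp_ge _ _ _ _ _ HP H1 H2). unfold d in *. lra. }
  intros Hv Hw. apply Rle_antisym; auto.
Qed.

Lemma cut_value_opp {G : sRS} (u : G) (P : nat -> G) (x : G) (v : R) :
  cut_value u P x v -> cut_value u P (-' x) (- v).
Proof.
  intros [H1 H2]. split; intros a Ha; [now apply H2|].
  rewrite opp_opp. apply H1. lra.
Qed.

Lemma cut_value_add {G : sRS} (u : G) (P : nat -> G) (x y : G) (v w : R) :
  chain_below u P -> cut_value u P x v -> cut_value u P y w ->
  cut_value u P (x +' y) (v + w).
Proof.
  intros HP [Hx Hx'] [Hy Hy']. split; intros a Ha.
  - replace a with ((v + (a - v - w) / 2) + (w + (a - v - w) / 2)) by lra.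
    apply upper_add; [exact HP|apply Hx; lra|apply Hy; lra].
  - replace a with ((- v + (a + v + w) / 2) + (- w + (a + v + w) / 2)) by lra.
    rewrite opp_add. apply upper_add; [exact HP|apply Hx'; lra|apply Hy'; lra].
Qed.

Lemma cut_value_smul {G : sRS} (u : G) (P : nat -> G) (r : R) (x : G) (v : R) :
  chain_below u P -> cut_value u P x v -> cut_value u P (r *' x) (r * v).
Proof.
  intros HP.
  assert (Hzero : cut_value u P (zero G) 0).
  { assert (H : forall a, 0 < a -> upper u P (zero G) a).
    { intros a Ha. apply upper_of_le; [exact HP|].
      apply smul_ge_0; [lra|exact (chain_unit_ge_0 _ _ HP)]. }
    split; [exact H|]. intros a Ha. rewrite <- (opp_unique (zero G) (zero G)).
    - apply H. lra.
    - apply add_0. }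
  assert (Hpos : forall s y w, 0 < s -> cut_value u P y w ->
    forall a, s * w < a -> upper u P (s *' y) a).
  { intros s y w Hs [Hy _] a Ha. replace a with (s * (a / s)) by (field; lra).
    apply upper_smul; [exact HP|lra|]. apply Hy.
    apply (Rmult_lt_reg_l s); [exact Hs|]. replace (s * (a / s)) with a by (field; lra).
    exact Ha. }
  assert (Hpos' : forall s y w, 0 < s -> cut_value u P y w ->
    cut_value u P (s *' y) (s * w)).
  { intros s y w Hs Hy. split; [now apply Hpos|]. intros a Ha.
    rewrite <- smul_oppr. apply (Hpos s _ (- w) Hs); [now apply cut_value_opp|lra]. }
  intros Hx. destruct (Rtotal_order r 0) as [Hr|[->|Hr]].
  - replace (r * v) with (- ((- r) * v)) by ring.
    rewrite <- (Ropp_involutive r) at 1. rewrite smul_oppl.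
    apply cut_value_opp, Hpos'; [lra|exact Hx].
  - rewrite smul_0l, Rmult_0_l. exact Hzero.
  - now apply Hpos'.
Qed.

Lemma opp_join_opp {G : sRS} (x y : G) : -' join G (-' x) (-' y) = meet G x y.
Proof.
  apply le_antisym.
  - apply meet_glb.
    + rewrite <- (opp_opp x) at 2. apply le_opp, join_ge_l.
    + rewrite <- (opp_opp y) at 2. apply le_opp, join_ge_r.
  - rewrite <- (opp_opp (meet G x y)). apply le_opp.
    apply join_lub; apply le_opp; [apply meet_le_l|apply meet_le_r].
Qed.

Lemma cut_value_join {G : sRS} (u : G) (P : nat -> G) (x y : G) (v w : R) :
  chain_below u P -> cut_value u P x v -> cut_value u P y w ->
  cut_value u P (join G x y) (Rmax v w).
Proof.
  intros HP [Hx Hx'] [Hy Hy']. split; intros a Ha.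
  - apply upper_join; [exact HP| |].
    + apply Hx. exact (Rle_lt_trans _ _ _ (Rmax_l _ _) Ha).
    + apply Hy. exact (Rle_lt_trans _ _ _ (Rmax_r _ _) Ha).
  - unfold Rmax in Ha. destruct (Rle_dec v w).
    + apply (upper_mono u P (-' y) _ a a HP);
        [apply le_opp, join_ge_r|lra|now apply Hy'].
    + apply (upper_mono u P (-' x) _ a a HP);
        [apply le_opp, join_ge_l|lra|now apply Hx'].
Qed.

Lemma cut_value_meet {G : sRS} (u : G) (P : nat -> G) (x y : G) (v w : R) :
  chain_below u P -> cut_value u P x v -> cut_value u P y w ->
  cut_value u P (meet G x y) (Rmin v w).
Proof.
  intros HP Hx Hy. rewrite <- opp_join_opp.
  replace (Rmin v w) with (- Rmax (- v) (- w)).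
  - apply cut_value_opp, cut_value_join; [exact HP| |]; now apply cut_value_opp.
  - rewrite <- Ropp_Rmin. ring.
Qed.

Lemma cut_value_unit {G : sRS} (u : G) (P : nat -> G) :
  chain_below u P -> cut_value u P u 1.
Proof.
  intros HP. pose proof (chain_unit_ge_0 _ _ HP) as Hu.
  split; intros a Ha; apply upper_of_le; try exact HP.
  - rewrite <- (smul_1 G u) at 1. apply smul_le_l; [lra|exact Hu].
  - rewrite <- (smul_1 G u) at 1. rewrite <- smul_oppl.
    apply smul_le_l; [lra|exact Hu].
Qed.

Definition cut_valuation {G : sRS} (u : G) (P : nat -> G) (HP : chain_below u P) :
  valuation G.
Proof.
  refine {| value := cut_value u P;
            value_unique := fun x v w => cut_value_unique u P x v w HP;
            value_add := fun x y v w => cut_value_add u P x y v w HP;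
            value_opp := cut_value_opp u P;
            value_join := fun x y v w => cut_value_join u P x y v w HP;
            value_meet := fun x y v w => cut_value_meet u P x y v w HP;
            value_smul := fun r x v => cut_value_smul u P r x v HP |}.
  (* The value of zero is read off from [0 u]. *)
  pose proof (cut_value_smul u P 0 u 1 HP (cut_value_unit u P HP)) as H.
  now rewrite smul_0l, Rmult_0_l in H.
Defined.

(** The value is the supremum of the forced lower bounds. A rational above it cannot be a lower
    bound, so by [Hdec] it is an upper bound. *)
Lemma cut_value_exists {G : sRS} (u : G) (P : nat -> G) (x : G) :
  chain_below u P ->
  (exists a, upper u P x a) -> (exists a, upper u P (-' x) a) ->
  (forall t, upper u P x (rational t) \/ upper u P (-' x) (- rational t)) ->
  exists v, cut_value u P x v.
Proof.
  intros HP [M HM] [N HN] Hdec.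
  destruct (completeness (fun a => upper u P (-' x) (- a))) as [v [Hub Hlub]].
  - exists M. intros a Ha. pose proof (upper_opp_ge _ _ _ _ _ HP HM Ha). lra.
  - exists (- N). now rewrite Ropp_involutive.
  - exists v. split; intros a Ha.
    + destruct (rational_dense v a Ha) as [t Ht]. destruct (Hdec t) as [H|H].
      * apply (upper_mono _ _ x x _ a HP) in H; [exact H|apply le_refl|lra].
      * apply Hub in H. lra.
    + apply NNPP. intros Hno. assert (Hv : v <= - a); [|lra].
      apply Hlub. intros b Hb. apply Rnot_lt_le. intros Hab. apply Hno.
      apply (upper_mono _ _ (-' x) (-' x) _ a HP) in Hb; [exact Hb|apply le_refl|lra].
Qed.

Lemma Rsup_seq_lub (w : nat -> R) (M : R) :
  (forall n, w n <= M) -> is_lub (fun x => exists n, x = w n) (Rsup_seq w).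
Proof.
  intros H. unfold Rsup_seq. apply epsilon_spec.
  destruct (completeness (fun x => exists n, x = w n)) as [l Hl].
  - exists M. intros x [n ->]. apply H.
  - exists (w 0%nat). now exists 0%nat.
  - now exists l.
Qed.

Lemma cut_value_bigv {G : sRS} (u : G) (P : nat -> G) (g : G) (f : nat -> G)
    (a : R) (b : nat -> R) :
  chain_below u P ->
  (forall t, upper u P (bigv G g f) (rational t) \/
     exists n, upper u P (-' meet G (f n) g) (- rational t)) ->
  cut_value u P g a -> (forall n, cut_value u P (f n) (b n)) ->
  cut_value u P (bigv G g f) (Rsup_seq (fun n => Rmin (b n) a)).
Proof.
  intros HP Hdec Hg Hf.
  assert (Hm : forall n, cut_value u P (meet G (f n) g) (Rmin (b n) a)).
  { intros n. now apply cut_value_meet. }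
  destruct (Rsup_seq_lub (fun n => Rmin (b n) a) a) as [Hub Hlub].
  { intros n. apply Rmin_r. }
  set (s := Rsup_seq _) in *. split; intros c Hc.
  - destruct (rational_dense s c Hc) as [t Ht]. destruct (Hdec t) as [H|[n H]].
    + apply (upper_mono _ _ (bigv G g f) (bigv G g f) _ c HP) in H;
        [exact H|apply le_refl|lra].
    (* The term [f n /\ g] has value at most [s < d], so [d] bounds it from above, while [H] bounds
       it from below by [rational t > d]. *)
    + set (d := (s + rational t) / 2).
      assert (Hn : Rmin (b n) a <= s) by (apply Hub; now exists n).
      pose proof (upper_opp_ge u P _ d _ HP (proj1 (Hm n) d ltac:(unfold d; lra)) H).
      unfold d in *. lra.
  (* A term of value above [- c] would carry its lower bound over to the larger [bigv G g f]. *)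
  - apply NNPP. intros Hno. assert (Hs : s <= - c); [|lra].
    apply Hlub. intros x [n ->]. apply Rnot_lt_le. intros Hlt. apply Hno.
    apply (upper_mono u P (-' meet G (f n) g) _ c c HP);
      [apply le_opp, bigv_ub|lra|]. apply (proj2 (Hm n)). lra.
Qed.

(** * Valuations respecting countably many suprema *)

Definition entry {G : sRS} (c : G * (nat -> G)) (k : nat) : G :=
  match k with 0%nat => fst c | S k => snd c k end.

(** Collects what [cut_value_exists] and [cut_value_bigv] ask of a chain. The form [- - r] makes the
    clauses instances of [upper] at [- r]. *)
Definition decides {G : sRS} (u : G) (c : G * (nat -> G)) (k t : nat) (p : G) : Prop :=
  let x := entry c k in let r := rational t in
  (exists a, forces_le0 p (x +' (- a) *' u)) /\
  (exists a, forces_le0 p (-' x +' (- a) *' u)) /\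
  (forces_le0 p (x +' (- r) *' u) \/ forces_le0 p (-' x +' (- - r) *' u)) /\
  (forces_le0 p (bigv G (fst c) (snd c) +' (- r) *' u) \/
   exists n, forces_le0 p (-' meet G (snd c n) (fst c) +' (- - r) *' u)).

(** Four successive refinements, one per clause; what is forced persists below. *)
Lemma decides_dense {G : sRS} (u : G) (c : G * (nat -> G)) (k t : nat) (p : G) :
  gt0 p -> p <=' u -> exists q, gt0 q /\ q <=' p /\ decides u c k t q.
Proof.
  intros Hp Hpu. unfold decides. set (x := entry c k). set (r := rational t).
  assert (E : forall z : G, -' (z +' (- r) *' u) = -' z +' (- - r) *' u).
  { intros z. now rewrite opp_add, <- smul_oppl. }
  destruct (forces_bounded p u x Hp Hpu) as (q1 & H1 & L1 & a & D1).
  pose proof (le_trans _ _ _ L1 Hpu) as U1.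
  destruct (forces_bounded q1 u (-' x) H1 U1) as (q2 & H2 & L2 & b & D2).
  destruct (forces_decide q2 (x +' (- r) *' u) H2) as (q3 & H3 & L3 & D3).
  destruct (forces_bigv_decide q3 (fst c) (r *' u) (snd c) H3) as (q & H4 & L4 & D4).
  rewrite <- smul_oppl in D4.
  assert (L42 : q <=' q2) by exact (le_trans _ _ _ L4 L3).
  assert (L41 : q <=' q1) by exact (le_trans _ _ _ L42 L2).
  assert (mono : forall q' z, q <=' q' -> forces_le0 q' z -> forces_le0 q z).
  { intros q' z. apply forces_anti, H4. }
  exists q. split; [exact H4|]. split; [exact (le_trans _ _ _ L41 L1)|].
  split; [exists a; exact (mono _ _ L41 D1)|].
  split; [exists b; exact (mono _ _ L42 D2)|].
  rewrite E in D3. split.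
  - destruct D3 as [D3|D3]; [left|right]; exact (mono _ _ L4 D3).
  - destruct D4 as [D4|[n D4]]; [now left|right; exists n].
    now rewrite E in D4.
Qed.

Lemma valuation_exists {G : sRS} (u : G) (c : nat -> G * (nat -> G)) :
  gt0 u -> exists V : valuation G, (forall n, respects V (c n)) /\ V u 1.
Proof.
  intros Hu.
  (* Nested Cantor pairing codes instance, entry and rational in one index. *)
  destruct (generic_sequence u (fun i => let (n, j) := of_nat i in
              let (k, t) := of_nat j in decides u (c n) k t) Hu) as (P & HP & HD).
  { intros i p Hp Hpu. destruct (of_nat i) as [n j], (of_nat j) as [k t].
    now apply decides_dense. }
  assert (D : forall n k t, exists m, decides u (c n) k t (P m)).
  { intros n k t. destruct (HD (to_nat (n, to_nat (k, t)))) as [m H].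
    exists m. now rewrite !cancel_of_to in H. }
  assert (HV : forall n k, exists v, cut_value u P (entry (c n) k) v).
  { intros n k. apply cut_value_exists; [exact HP| | |].
    - destruct (D n k 0%nat) as (m & [a H] & _). now exists a, m.
    - destruct (D n k 0%nat) as (m & _ & [a H] & _). now exists a, m.
    - intros t. destruct (D n k t) as (m & _ & _ & [H|H] & _);
        [left|right]; now exists m. }
  exists (cut_valuation u P HP). split; [|now apply cut_value_unit].
  (* The clause about the supremum does not depend on the entry, so entry 0 serves. *)
  intros n. pose proof (HV n) as Hn. pose proof (D n 0%nat) as Dn.
  unfold decides in Dn. destruct (c n) as [g f]. split; [|split].
  - exact (Hn 0%nat).
  - intros k. exact (Hn (S k)).
  - intros a b Ha Hb. apply cut_value_bigv; [exact HP| |exact Ha|exact Hb].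
    intros t. destruct (Dn t) as (m & _ & _ & _ & [H|[k H]]);
      [left; now exists m|right; exists k; now exists m].
Qed.

(** * The embedding *)

(** Arbitrary where [V] leaves [x] undefined; by [almost_all_value] such [V] are negligible. *)
Definition eval {G : sRS} (x : G) (V : valuation G) : R := epsilon (inhabits 0) (V x).

Lemma eval_eq {G : sRS} (V : valuation G) (x : G) (a : R) : V x a -> eval x V = a.
Proof.
  intros H. apply (value_unique G V x); [|exact H].
  exact (epsilon_spec (inhabits 0) (V x) (ex_intro _ a H)).
Qed.

Lemma eval_value {G : sRS} (V : valuation G) (x : G) :
  (exists a, V x a) -> V x (eval x V).
Proof. exact (epsilon_spec (inhabits 0) (V x)). Qed.

Definition almost_all {G : sRS} (Q : valuation G -> Prop) : Prop :=
  exists c : nat -> G * (nat -> G),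
    forall V, (forall n, respects V (c n)) -> Q V.

(** Choice picks a family for each [n], and pairing merges them into one. This countable closure is
    what makes [almost_equal] compatible with [bigv]. *)
Lemma almost_all_countable {G : sRS} (Q : nat -> valuation G -> Prop) :
  (forall n, almost_all (Q n)) -> almost_all (fun V => forall n, Q n V).
Proof.
  intros H.
  set (c := fun n => proj1_sig (constructive_indefinite_description _ (H n))).
  exists (fun i => let (n, k) := of_nat i in c n k).
  intros V HV n. unfold c in HV.
  apply (proj2_sig (constructive_indefinite_description _ (H n))).
  intros k. specialize (HV (to_nat (n, k))). now rewrite cancel_of_to in HV.
Qed.

Lemma almost_all_mono {G : sRS} (Q Q' : valuation G -> Prop) :
  (forall V, Q V -> Q' V) -> almost_all Q -> almost_all Q'.
Proof. intros HQ [c Hc]. exists c. auto. Qed.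

Lemma almost_all_and {G : sRS} (Q Q' : valuation G -> Prop) :
  almost_all Q -> almost_all Q' -> almost_all (fun V => Q V /\ Q' V).
Proof.
  intros H H'.
  apply (almost_all_mono (fun V => forall n, match n with 0%nat => Q V | _ => Q' V end)).
  - intros V HV. split; [exact (HV 0%nat)|exact (HV 1%nat)].
  - apply (almost_all_countable
             (fun n V => match n with 0%nat => Q V | _ => Q' V end)).
    now intros [|n].
Qed.

Lemma almost_all_respects {G : sRS} (g : G) (f : nat -> G) :
  almost_all (fun V => respects V (g, f)).
Proof. exists (fun _ => (g, f)). intros V HV. exact (HV 0%nat). Qed.

Lemma almost_all_value {G : sRS} (x : G) : almost_all (fun V => V x (eval x V)).
Proof.
  (* Respecting any instance that contains [x] puts [x] in the domain. *)
  apply (almost_all_mono (fun V => respects V (x, fun _ => x)));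
    [|apply almost_all_respects].
  intros V [Hx _]. now apply eval_value.
Qed.

Lemma almost_all_value2 {G : sRS} (x y : G) :
  almost_all (fun V => V x (eval x V) /\ V y (eval y V)).
Proof. apply almost_all_and; apply almost_all_value. Qed.

Definition almost_equal {G : sRS} (a b : valuation G -> R) : Prop :=
  almost_all (fun V => a V = b V).

Lemma almost_equal_map2 {G : sRS} (F : R -> R -> R) (a a' b b' : valuation G -> R) :
  almost_equal a a' -> almost_equal b b' ->
  almost_equal (fun V => F (a V) (b V)) (fun V => F (a' V) (b' V)).
Proof.
  intros Ha Hb. apply (almost_all_mono _ _) with (2 := almost_all_and _ _ Ha Hb).
  intros V [-> ->]. reflexivity.
Qed.

Lemma almost_equal_congruence (G : sRS) : pw_congruence (@almost_equal G).
Proof.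
  assert (refl : forall a, almost_equal (G := G) a a).
  { intros a. now exists (fun _ => (zero G, fun _ => zero G)). }
  repeat split.
  - exact refl.
  - intros a b. apply almost_all_mono. auto.
  - intros a b c Ha Hb. apply (almost_all_mono _ _) with (2 := almost_all_and _ _ Ha Hb).
    intros V [-> ->]. reflexivity.
  - intros a a' b b'. apply (almost_equal_map2 Rplus).
  - intros a a' Ha. exact (almost_equal_map2 (fun r _ => - r) _ _ _ _ Ha Ha).
  - intros a a' b b'. apply (almost_equal_map2 Rmax).
  - intros a a' b b'. apply (almost_equal_map2 Rmin).
  - intros r a a' Ha. exact (almost_equal_map2 (fun s _ => r * s) _ _ _ _ Ha Ha).
  - intros g g' f f' Hg Hf. apply almost_all_countable in Hf.
    apply (almost_all_mono _ _) with (2 := almost_all_and _ _ Hg Hf).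
    intros V [Eg Ef]. unfold pw_bigv. rewrite Eg. f_equal.
    extensionality n. now rewrite Ef.
Qed.

(** Otherwise [u = pos (x - y)] is positive and gets value 1 under some valuation respecting the
    witnessing family, whereas equal values of [x] and [y] give it value 0. *)
Lemma le_of_eval_almost_equal {G : sRS} (x y : G) :
  almost_equal (eval x) (eval y) -> x <=' y.
Proof.
  intros H. apply NNPP. intros Hxy.
  set (u := pos (x +' -' y)).
  assert (Hu : gt0 u).
  { split; [apply pos_ge_0|]. intros E. apply Hxy.
    rewrite <- (add_0l y). apply le_addl. rewrite <- E. apply pos_ge. }
  (* The family is enlarged so that [V] is defined at [x] and [y], making [eval] their true
     value. *)
  destruct (almost_all_and _ _ (almost_all_value2 x y) H) as [c Hc].
  destruct (valuation_exists u c Hu) as (V & HV & Hu1).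
  destruct (Hc V HV) as [[Hx Hy] Hxy'].
  assert (Hu0 : V u (Rmax (eval x V + - eval y V) 0)).
  { apply value_join; [|apply value_zero].
    apply value_add; [exact Hx|now apply value_opp]. }
  rewrite Hxy', Rplus_opp_r, Rmax_left in Hu0 by lra.
  pose proof (value_unique G V u _ _ Hu1 Hu0). lra.
Qed.

Lemma eval_embeds (G : sRS) : embeds_mod G (@almost_equal G) eval.
Proof.
  repeat split.
  - intros x y H. apply le_antisym; apply le_of_eval_almost_equal; [exact H|].
    revert H. apply almost_all_mono. auto.
  - apply (almost_all_mono _ _) with (2 := almost_all_value (zero G)).
    intros V _. apply eval_eq, value_zero.
  - intros x y. apply (almost_all_mono _ _) with (2 := almost_all_value2 x y).
    intros V [Hx Hy]. now apply eval_eq, value_add.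
  - intros x. apply (almost_all_mono _ _) with (2 := almost_all_value x).
    intros V Hx. now apply eval_eq, value_opp.
  - intros x y. apply (almost_all_mono _ _) with (2 := almost_all_value2 x y).
    intros V [Hx Hy]. now apply eval_eq, value_join.
  - intros x y. apply (almost_all_mono _ _) with (2 := almost_all_value2 x y).
    intros V [Hx Hy]. now apply eval_eq, value_meet.
  - intros r x. apply (almost_all_mono _ _) with (2 := almost_all_value x).
    intros V Hx. now apply eval_eq, value_smul.
  - intros g f. apply (almost_all_mono _ _) with (2 := almost_all_respects g f).
    intros V (Hg & Hf & Hb). apply eval_eq, Hb; [now apply eval_value|].
    intros n. now apply eval_value.
Qed.

Theorem mainTheorem14 (G : sRS) :
  exists (I : Type) (th : (I -> R) -> (I -> R) -> Prop) (h : G -> I -> R),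
    pw_congruence th /\ embeds_mod G th h.
Proof.
  exists (valuation G), almost_equal, eval.
  split; [apply almost_equal_congruence|apply eval_embeds].
Qed.
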